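(* For every integer $n\geq 1$, the following twelve identities hold in $\mathbb{Z}[x]$: (1) $xF_{n}(x)+(4x^3-x^2-3x)F_{n-1}(x)=T_{2n-1}(x)-\sum_{k=1}^{n-2}\bigl((4x^2-x-2)T_{2(n-k)-1}(x)-2T_{2(n-k)-3}(x)\bigr)F_{k}(x)$; (2) $2xF_{n}(x)+(8x^3-2x^2-4x)F_{n-1}(x)= U_{2n-1}(x)-\sum_{k=1}^{n-2}\bigl((4x^2-x-2)U_{2(n-k)-1}(x)-2U_{2(n-k)-3}(x)\bigr)F_{k}(x)$; (3) $F_{n}(x)+(2x^2-x-1)F_{n-1}(x)=T_{2n-2}(x)-\sum_{k=1}^{n-2}\bigl((4x^2-x-2)T_{2(n-k-1)}(x)-2T_{2(n-k-2)}(x)\bigr)F_{k}(x)$; (4) $F_{n}(x)+(4x^2-x-1)F_{n-1}(x)=U_{2n-2}(x)-\sum_{k=1}^{n-2}\bigl((4x^2-x-2)U_{2(n-k-1)}(x)-2U_{2(n-k-2)}(x)\bigr)F_{k}(x)$; (5) $F_{2n+1}(x)-(2x^2-1)F_{2n-1}(x)=T_{2n}(x)-T_{2n-2}(x)-(3x^2-4)\sum_{k=0}^{n-1}T_{2(n-k-1)}(x)F_{2k+1}(x)$; (6) $F_{2n+1}(x)+F_{2n-1}(x)=U_{2n}(x)-U_{2n-2}(x)-(3x^2-4)\sum_{k=0}^{n-1}U_{2(n-k-1)}(x)F_{2k+1}(x)$; (7) $x^2F_{2n-1}(x)=xT_{2n-1}(x)-(3x^2-4)\sum_{k=1}^{n-1}T_{2(n-k)-1}(x)F_{2k}(x)$;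 (8) $2xF_{2n}(x)= xU_{2n-1}(x)-(3x^2-4)\sum_{k=1}^{n-1}U_{2(n-k)-1}(x)F_{2k}(x)$; (9) $F_{2n+1}(x)-xF_{2n-1}(x) = T_n(x)-T_{n-1}(x)+(x^2-2x+2)\sum_{k=0}^{n-1}T_{n-1-k}(x)F_{2k+1}(x)$; (10) $F_{2n+1}(x) = U_n(x)-U_{n-1}(x)+(x^2-2x+2)\sum_{k=0}^{n-1}U_{n-1-k}(x)F_{2k+1}(x)$; (11) $F_{2n}(x)-xF_{2n-2}(x) =xT_{n-1}(x)+(x^2-2x+2)\sum_{k=1}^{n-1}T_{n-1-k}(x)F_{2k}(x)$; (12) $F_{2n}(x) = xU_{n-1}(x)+(x^2-2x+2)\sum_{k=1}^{n-1}U_{n-1-k}(x)F_{2k}(x)$.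
   Context: The Chebyshev polynomials of the first kind $T_n(x)$ and of the second kind $U_n(x)$ are defined by $T_0(x)=1$, $T_1(x)=x$, $T_{n+1}(x)=2xT_n(x)-T_{n-1}(x)$, and $U_0(x)=1$, $U_1(x)=2x$, $U_{n+1}(x)=2xU_n(x)-U_{n-1}(x)$ for $n\ge 1$. The (Catalan) Fibonacci polynomials $F_n(x)$ are defined by $F_0(x)=0$, $F_1(x)=1$, $F_n(x)=xF_{n-1}(x)+F_{n-2}(x)$ for $n\geq 2$. A sum whose upper limit is smaller than its lower limit is $0$. *)

(* Defs.v *)
From mathcomp Require Import all_boot all_order all_algebra.
Set Implicit Arguments.
Unset Strict Implicit.
Unset Printing Implicit Defensive.
Import GRing.Theory.
Local Open Scope ring_scope.

Fixpoint chebyshevT (n : nat) : {poly int} :=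
  match n with
  | 0 => 1
  | 1 => 'X
  | (m.+1 as p).+1 => 2 * 'X * chebyshevT p - chebyshevT m
  end.

Fixpoint chebyshevU (n : nat) : {poly int} :=
  match n with
  | 0 => 1
  | 1 => 2 * 'X
  | (m.+1 as p).+1 => 2 * 'X * chebyshevU p - chebyshevU m
  end.

Fixpoint fibonacci_poly (n : nat) : {poly int} :=
  match n with
  | 0 => 0
  | 1 => 1
  | (m.+1 as p).+1 => 'X * fibonacci_poly p + fibonacci_poly m
  end.

(* Main.v *)
(** If [P (m+2) = a P (m+1) - b P m] and [Q (m+2) = c Q (m+1) - d Q m], then with
    [G k = P (n+1-k) Q (k+1) - d P (n-k) Q k] one has
    [G k - G (k+1) = ((a-c) P (n-k) - (b-d) P (n-k-1)) Q (k+1)], so the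
    convolution of [P] and [Q] telescopes.  All twelve identities are instances:
    a Chebyshev sequence [W] has [(a, b) = (2x, 1)], and [(4x^2-2, 1)] along
    indices of one parity; the Fibonacci polynomials have [(c, d) = (x, -1)], and
    [(x^2+2, 1)] along indices of one parity. *)
Require Import Defs.
From mathcomp Require Import all_boot all_order all_algebra.
From mathcomp Require Import zify ring.
Import GRing.Theory.
Local Open Scope ring_scope.

Section Convolution.

Variables (R : comPzRingType) (a b c d : R) (P Q : nat -> R).
Hypothesis PE : forall m, P m.+2 = a * P m.+1 - b * P m.
Hypothesis QE : forall m, Q m.+2 = c * Q m.+1 - d * Q m.

Lemma convolution_telescope n :
  \sum_(0 <= k < n) ((a - c) * P (n - k)%N - (b - d) * P (n - k.+1)%N) * Q k.+1
    = P n.+1 * Q 1%N - d * P n * Q 0%N - P 1%N * Q n.+1 + d * P 0%N * Q n.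
Proof.
(* This is minus the [G] described at the top, since [telescope_sumr] adds up differences
   [G k.+1 - G k]. *)
pose G k := d * P (n - k)%N * Q k - P (n.+1 - k)%N * Q k.+1.
rewrite (eq_big_nat _ _ (F2 := fun k => G k.+1 - G k)) => [|k /andP[_ ltkn]].
  by rewrite telescope_sumr // /G subnn !subn0 subSnn; ring.
(* With [k < n], the truncated differences become [j], [j.+1], [j.+2], so that [PE] applies at
   [j]. *)
have [j nE] : exists j, n = (j + k.+1)%N by exists (n - k.+1)%N; lia.
rewrite /G subSS.
have -> : (n - k.+1 = j)%N by lia.
have -> : (n - k = j.+1)%N by lia.
have -> : (n.+1 - k = j.+2)%N by lia.
by rewrite PE QE; ring.
Qed.

End Convolution.
Arguments convolution_telescope {R a b c d P Q}.

(** With [d = b] only one convolution survives the telescoping. Extending both sequences one step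
    backwards would give [Q 1 - c * Q 0 = - b * Q (-1)], and likewise for [P]; writing the boundary
    terms this way avoids negative indices and division by [b]. *)
Lemma convolution_same_const {R : comPzRingType} {a b c : R} {P Q : nat -> R}
    (PE : forall m, P m.+2 = a * P m.+1 - b * P m)
    (QE : forall m, Q m.+2 = c * Q m.+1 - b * Q m) n :
  (a - c) * \sum_(0 <= k < n.+1) P (n - k)%N * Q k
    = P n.+1 * Q 0%N + P n * (Q 1%N - c * Q 0%N)
      - P 0%N * Q n.+1 - Q n * (P 1%N - a * P 0%N).
Proof.
case: n => [|n]; first by rewrite big_nat1 subnn; ring.
(* The telescoping sum covers only the inner indices, so the two end terms are split off. *)
rewrite big_nat_recl // big_nat_recr //= subn0 subSS subnn.
have := convolution_telescope PE QE n.
rewrite (eq_bigr (fun k => (a - c) * (P (n - k)%N * Q k.+1))) => [|k _]; last by ring.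
rewrite -mulr_sumr => tele.
rewrite (eq_bigr (fun k => P (n - k)%N * Q k.+1)) => [|k _]; last by rewrite subSS.
by rewrite !mulrDr tele PE QE; ring.
Qed.

Local Notation F := fibonacci_poly.

Lemma chebyshevTE m : chebyshevT m.+2 = 2 * 'X * chebyshevT m.+1 - chebyshevT m.
Proof. by []. Qed.

Lemma chebyshevUE m : chebyshevU m.+2 = 2 * 'X * chebyshevU m.+1 - chebyshevU m.
Proof. by []. Qed.

Lemma fibonacciE m : F m.+2 = 'X * F m.+1 + F m.
Proof. by []. Qed.

(** The factor [1 *] keeps the shape of the recurrence hypotheses of the convolution lemmas. *)
Lemma fibonacci_step2 m : F m.+4 = ('X ^+ 2 + 2) * F m.+2 - 1 * F m.
Proof. by rewrite (fibonacciE m.+2) (fibonacciE m.+1) (fibonacciE m); ring. Qed.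

Section ChebyshevFibonacci.

Variable W : nat -> {poly int}.
Hypothesis WE : forall m, W m.+2 = 2 * 'X * W m.+1 - W m.

Lemma chebyshev_step2 m : W m.+4 = (4 * 'X ^+ 2 - 2) * W m.+2 - 1 * W m.
Proof. by rewrite (WE m.+2) (WE m.+1) (WE m); ring. Qed.

Lemma chebyshev_parity r m :
  W (2 * m.+2 + r)%N = (4 * 'X ^+ 2 - 2) * W (2 * m.+1 + r)%N - 1 * W (2 * m + r)%N.
Proof. by rewrite !mulnS -!addnA chebyshev_step2. Qed.

Lemma fibonacci_parity r m :
  F (2 * m.+2 + r)%N = ('X ^+ 2 + 2) * F (2 * m.+1 + r)%N - 1 * F (2 * m + r)%N.
Proof. by rewrite !mulnS -!addnA fibonacci_step2. Qed.

(** Used for (1)-(4), with [r] the parity of the Chebyshev indices. The constants 1 and -1 differ by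
    2, so both terms of the telescoping summand remain. *)
Lemma sum_parity_fibonacci r n :
  \sum_(1 <= k < n.+1) ((4 * 'X ^+ 2 - 'X - 2) * W (2 * (n.+1 - k) + r)%N
                        - 2 * W (2 * (n - k) + r)%N) * F k
    = W (2 * n.+1 + r)%N - W (2 + r)%N * F n.+1 - W r * F n.
Proof.
have FE m : F m.+2 = 'X * F m.+1 - (- 1) * F m by rewrite fibonacciE; ring.
have := convolution_telescope (chebyshev_parity r) FE n.
rewrite big_add1 /= muln1 muln0 add0n mulr0 mulr1 subr0 mulN1r mulNr => tele.
rewrite -tele; apply: eq_bigr => k _.
by rewrite subSS; ring.
Qed.

(** Here [a - c] is [(4x^2 - 2) - (x^2 + 2) = 3x^2 - 4]. The pair [(r, s) = (0, 1)] serves (5) and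
    (6), and [(1, 0)] serves (7) and (8). *)
Lemma conv_parity_parity r s n :
  (3 * 'X ^+ 2 - 4) * \sum_(0 <= k < n.+1) W (2 * (n - k) + r)%N * F (2 * k + s)%N
    = W (2 * n.+1 + r)%N * F s + W (2 * n + r)%N * (F (2 + s)%N - ('X ^+ 2 + 2) * F s)
      - W r * F (2 * n.+1 + s)%N
      - F (2 * n + s)%N * (W (2 + r)%N - (4 * 'X ^+ 2 - 2) * W r).
Proof.
rewrite -(convolution_same_const (chebyshev_parity r) (fibonacci_parity s)).
by congr (_ * _); ring.
Qed.

(** Here [a - c] is [2x - (x^2 + 2)], the negative of the stated factor, hence the reversed signs.
    Used for (9)-(12). *)
Lemma conv_fibonacci_parity s n :
  ('X ^+ 2 - 2 * 'X + 2) * \sum_(0 <= k < n.+1) W (n - k)%N * F (2 * k + s)%N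
    = F (2 * n + s)%N * (W 1%N - 2 * 'X * W 0%N) + W 0%N * F (2 * n.+1 + s)%N
      - W n * (F (2 + s)%N - ('X ^+ 2 + 2) * F s) - W n.+1 * F s.
Proof.
have WE1 m : W m.+2 = 2 * 'X * W m.+1 - 1 * W m by rewrite WE mul1r.
have := convolution_same_const WE1 (fibonacci_parity s) n.
rewrite muln1 muln0 add0n => conv.
rewrite -[LHS]opprK -mulNr.
have -> : - ('X ^+ 2 - 2 * 'X + 2) = 2 * 'X - ('X ^+ 2 + 2) :> {poly int} by ring.
by rewrite conv; ring.
Qed.

End ChebyshevFibonacci.

Theorem theorem3 (n : nat) (hn : (1 <= n)%N) :
  let T := chebyshevT in
  let U := chebyshevU in
  let F := fibonacci_poly in
  let x : {poly int} := 'X in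
  (* (1) *)
  (x * F n + (4 * x ^+ 3 - x ^+ 2 - 3 * x) * F (n - 1)%N
     = T (2 * n - 1)%N
       - \sum_(1 <= k < n - 1)
           ((4 * x ^+ 2 - x - 2) * T (2 * (n - k) - 1)%N
            - 2 * T (2 * (n - k) - 3)%N) * F k) /\
  (* (2) *)
  (2 * x * F n + (8 * x ^+ 3 - 2 * x ^+ 2 - 4 * x) * F (n - 1)%N
     = U (2 * n - 1)%N
       - \sum_(1 <= k < n - 1)
           ((4 * x ^+ 2 - x - 2) * U (2 * (n - k) - 1)%N
            - 2 * U (2 * (n - k) - 3)%N) * F k) /\
  (* (3) *)
  (F n + (2 * x ^+ 2 - x - 1) * F (n - 1)%N
     = T (2 * n - 2)%N
       - \sum_(1 <= k < n - 1)
           ((4 * x ^+ 2 - x - 2) * T (2 * (n - k - 1))%N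
            - 2 * T (2 * (n - k - 2))%N) * F k) /\
  (* (4) *)
  (F n + (4 * x ^+ 2 - x - 1) * F (n - 1)%N
     = U (2 * n - 2)%N
       - \sum_(1 <= k < n - 1)
           ((4 * x ^+ 2 - x - 2) * U (2 * (n - k - 1))%N
            - 2 * U (2 * (n - k - 2))%N) * F k) /\
  (* (5) *)
  (F (2 * n + 1)%N - (2 * x ^+ 2 - 1) * F (2 * n - 1)%N
     = T (2 * n)%N - T (2 * n - 2)%N
       - (3 * x ^+ 2 - 4)
         * \sum_(0 <= k < n) T (2 * (n - k - 1))%N * F (2 * k + 1)%N) /\
  (* (6) *)
  (F (2 * n + 1)%N + F (2 * n - 1)%N
     = U (2 * n)%N - U (2 * n - 2)%N
       - (3 * x ^+ 2 - 4)
         * \sum_(0 <= k < n) U (2 * (n - k - 1))%N * F (2 * k + 1)%N) /\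
  (* (7) *)
  (x ^+ 2 * F (2 * n - 1)%N
     = x * T (2 * n - 1)%N
       - (3 * x ^+ 2 - 4)
         * \sum_(1 <= k < n) T (2 * (n - k) - 1)%N * F (2 * k)%N) /\
  (* (8) *)
  (2 * x * F (2 * n)%N
     = x * U (2 * n - 1)%N
       - (3 * x ^+ 2 - 4)
         * \sum_(1 <= k < n) U (2 * (n - k) - 1)%N * F (2 * k)%N) /\
  (* (9) *)
  (F (2 * n + 1)%N - x * F (2 * n - 1)%N
     = T n - T (n - 1)%N
       + (x ^+ 2 - 2 * x + 2)
         * \sum_(0 <= k < n) T (n - 1 - k)%N * F (2 * k + 1)%N) /\
  (* (10) *)
  (F (2 * n + 1)%N
     = U n - U (n - 1)%N
       + (x ^+ 2 - 2 * x + 2)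
         * \sum_(0 <= k < n) U (n - 1 - k)%N * F (2 * k + 1)%N) /\
  (* (11) *)
  (F (2 * n)%N - x * F (2 * n - 2)%N
     = x * T (n - 1)%N
       + (x ^+ 2 - 2 * x + 2)
         * \sum_(1 <= k < n) T (n - 1 - k)%N * F (2 * k)%N) /\
  (* (12) *)
  (F (2 * n)%N
     = x * U (n - 1)%N
       + (x ^+ 2 - 2 * x + 2)
         * \sum_(1 <= k < n) U (n - 1 - k)%N * F (2 * k)%N).
Proof.
move=> T U F x; case: n hn => // n _.
have -> : (n.+1 - 1 = n)%N by lia.
have -> : (2 * n.+1 - 1 = 2 * n + 1)%N by lia.
have -> : (2 * n.+1 - 2 = 2 * n + 0)%N by lia.
(* The closed form involves the Fibonacci polynomial at [n - 1], so the empty sum at [n = 0] is a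
   separate branch. *)
have W1 (W : nat -> {poly int}) (WE : forall m, W m.+2 = 2 * x * W m.+1 - W m) :
    \sum_(1 <= k < n) ((4 * x ^+ 2 - x - 2) * W (2 * (n.+1 - k) - 1)%N
                      - 2 * W (2 * (n.+1 - k) - 3)%N) * F k
    = if n is m.+1 then W (2 * n + 1)%N - W 3%N * F n - W 1%N * F m else 0.
  case: (n) => [|m]; first by rewrite big_geq.
  rewrite -(sum_parity_fibonacci _ WE 1); apply: eq_big_nat => k /andP[_ ltkm].
  by congr ((_ * W _ - _ * W _) * _); lia.
have W0 (W : nat -> {poly int}) (WE : forall m, W m.+2 = 2 * x * W m.+1 - W m) :
    \sum_(1 <= k < n) ((4 * x ^+ 2 - x - 2) * W (2 * (n.+1 - k - 1))%N
                      - 2 * W (2 * (n.+1 - k - 2))%N) * F k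
    = if n is m.+1 then W (2 * n + 0)%N - W 2%N * F n - W 0%N * F m else 0.
  case: (n) => [|m]; first by rewrite big_geq.
  rewrite -(sum_parity_fibonacci _ WE 0); apply: eq_big_nat => k /andP[_ ltkm].
  by congr ((_ * W _ - _ * W _) * _); lia.
have W5 (W : nat -> {poly int}) :
    \sum_(0 <= k < n.+1) W (2 * (n.+1 - k - 1))%N * F (2 * k + 1)%N
    = \sum_(0 <= k < n.+1) W (2 * (n - k) + 0)%N * F (2 * k + 1)%N.
  by apply: eq_big_nat => k /andP[_ ltkn]; congr (W _ * _); lia.
(* The sum may start at [k = 0] because [F 0 = 0]. *)
have W7 (W : nat -> {poly int}) :
    \sum_(1 <= k < n.+1) W (2 * (n.+1 - k) - 1)%N * F (2 * k)%N
    = \sum_(0 <= k < n.+1) W (2 * (n - k) + 1)%N * F (2 * k + 0)%N.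
  rewrite [RHS]big_ltn // muln0 mulr0 add0r.
  by apply: eq_big_nat => k /andP[_ ltkn]; congr (W _ * F _); lia.
have W11 (W : nat -> {poly int}) :
    \sum_(1 <= k < n.+1) W (n - k)%N * F (2 * k)%N
    = \sum_(0 <= k < n.+1) W (n - k)%N * F (2 * k + 0)%N.
  rewrite [RHS]big_ltn // muln0 mulr0 add0r.
  by apply: eq_bigr => k _; rewrite addn0.
have TE := chebyshevTE; have UE := chebyshevUE; have FE := fibonacciE.
rewrite !W5 !W7 !W11 !(W1 _ TE) !(W1 _ UE) !(W0 _ TE) !(W0 _ UE).
rewrite !(conv_parity_parity _ TE) !(conv_parity_parity _ UE).
rewrite !(conv_fibonacci_parity _ TE) !(conv_fibonacci_parity _ UE).
(* Exposing successors lets the recurrences reduce all terms to a few consecutive indices, leaving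
   ring identities. *)
have -> : (2 * n.+1 = (2 * n).+2)%N by lia.
rewrite !addSn !addn1 !addn0 /T /U /F /x !TE !UE !FE.
have -> : chebyshevT 0 = 1 by [].
have -> : chebyshevT 1 = 'X by [].
have -> : chebyshevU 0 = 1 by [].
have -> : chebyshevU 1 = 2 * 'X by [].
have -> : fibonacci_poly 0 = 0 by [].
have -> : fibonacci_poly 1 = 1 by [].
(* The case split resolves the [match] on [n] left in (1)-(4). *)
by do !split; first [ring | case: (n) => [|m]; rewrite ?muln0 ?FE /=; ring].
Qed.
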